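(* Let $k,\ell>2$ be integers. If $\ell$ is even, then $$\gamma_{gr}^{t}(P_k\circ P_\ell)=\begin{cases}\frac{k}{2}\cdot\ell+1, & k\text{ even},\\ \left\lceil\frac{k}{2}\right\rceil\cdot\ell, & k\text{ odd}.\end{cases}$$ If $\ell$ is odd, then $$\gamma_{gr}^{t}(P_k\circ P_\ell)=\begin{cases}\frac{k}{2}\cdot(\ell-1)+1, & k\text{ even},\\ \left\lceil\frac{k}{2}\right\rceil\cdot(\ell-1), & k\text{ odd}.\end{cases}$$
   Context: $P_n$ denotes the path on $n$ vertices. $N(v)$ denotes the open neighborhood of $v$. A sequence $(v_1,\ldots,v_m)$ of distinct vertices of a graph $G$ is a (legal) open neighborhood sequence if $N(v_i)\setminus\bigcup_{j=1}^{i-1}N(v_j)\neq\emptyset$ for each $i$. The Grundy total domination number $\gamma_{gr}^{t}(G)$ is the maximum length of a legal open neighborhood sequence of $G$. The lexicographic product $G\circ H$ has vertex set $V(G)\times V(H)$, and $(g_1,h_1)$, $(g_2,h_2)$ are adjacent iff $g_1g_2\in E(G)$, or $g_1=g_2$ and $h_1h_2\in E(H)$. *)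

(* Defs.v *)
From mathcomp Require Import all_boot.

Set Implicit Arguments.
Unset Strict Implicit.
Unset Printing Implicit Defensive.

Record sgraph := SGraph {
  vertex :> finType;
  edge : rel vertex;
  edge_sym : symmetric edge;
  edge_irrefl : irreflexive edge
}.

Definition open_nbhd (G : sgraph) (v : G) : {set G} := [set w | edge v w].

Definition open_nbhd_seq (G : sgraph) (m : nat) (t : m.-tuple G) : bool :=
  uniq t &&
  [forall i : 'I_m,
     open_nbhd (tnth t i)
       :\: \bigcup_(j < m | j < i) open_nbhd (tnth t j) != set0].

(* The bound m <= #|G| loses nothing, since the entries are distinct: see
   [leq_grundy_total_dom]. *)
Definition grundy_total_dom (G : sgraph) : nat :=
  \max_(m < #|G|.+1 | [exists t : m.-tuple G, open_nbhd_seq t]) m.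

Lemma leq_grundy_total_dom (G : sgraph) (m : nat) (t : m.-tuple G) :
  open_nbhd_seq t -> m <= grundy_total_dom G.
Proof.
move=> ht; have m_le : m < #|G|.+1.
  case/andP: ht => /card_uniqP; rewrite size_tuple => card_t _.
  by rewrite ltnS -card_t max_card.
by apply: (bigmax_sup (Ordinal m_le)) => //; apply/existsP; exists t.
Qed.

Lemma grundy_total_dom_attained (G : sgraph) :
  exists t : (grundy_total_dom G).-tuple G, open_nbhd_seq t.
Proof.
rewrite /grundy_total_dom.
have h0 : [exists t : (@ord0 #|G|).-tuple G, open_nbhd_seq t].
  by apply/existsP; exists [tuple]; apply/andP; split=> //; apply/forallP=> -[].
rewrite (bigmax_eq_arg (ord0 : 'I_#|G|.+1)) //.
by case: arg_maxnP => // i /existsP.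
Qed.

Definition path_rel (n : nat) : rel 'I_n :=
  [rel i j : 'I_n | (i.+1 == j :> nat) || (j.+1 == i :> nat)].

Lemma path_rel_sym (n : nat) : symmetric (@path_rel n).
Proof. by move=> i j; rewrite /path_rel /= orbC. Qed.

Lemma path_rel_irrefl (n : nat) : irreflexive (@path_rel n).
Proof. by move=> i; rewrite /path_rel /= orbb gtn_eqF. Qed.

Definition path_graph (n : nat) : sgraph :=
  SGraph (@path_rel_sym n) (@path_rel_irrefl n).

Definition lex_rel (G H : sgraph) : rel (G * H) :=
  [rel x y | edge x.1 y.1 || ((x.1 == y.1) && edge x.2 y.2)].

Lemma lex_rel_sym (G H : sgraph) : symmetric (@lex_rel G H).
Proof.
move=> x y; rewrite /lex_rel /=.
by rewrite (@edge_sym G) (@edge_sym H) (eq_sym x.1).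
Qed.

Lemma lex_rel_irrefl (G H : sgraph) : irreflexive (@lex_rel G H).
Proof.
by move=> x; rewrite /lex_rel /= (@edge_irrefl G) (@edge_irrefl H) andbF.
Qed.

Definition lex_prod (G H : sgraph) : sgraph :=
  SGraph (@lex_rel_sym G H) (@lex_rel_irrefl G H).

(* Main.v *)
(* Write [T = 2 * (l / 2)], the Grundy total domination number of [P_l]; call
   the copies of [P_l] in [P_k o P_l] rows.  A play dominates the adjacent rows
   entirely.  Charge every play to a row where it footprints a vertex, to its
   own row when possible.  A row receives at most [T] charges.  If it receives
   at least two, it was played before its neighbours, so the next row can only
   be charged from the row after it; this property propagates along the path
   until a row without charges occurs.  Hence between two rows with at least two
   charges there is always one with none, which gives the upper bound.  For the
   lower bound, play optimally inside every other row; when [k] is even, rows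
   0, 3, 5, ... leave space for one additional play in row 1. *)

Require Import Defs.
From mathcomp Require Import all_boot.
From mathcomp Require Import zify.

Set Implicit Arguments.
Unset Strict Implicit.
Unset Printing Implicit Defensive.

(** Played in increasing order of [rk], each [v] footprints [f v]; ties may be broken
    arbitrarily. *)
Lemma leq_grundy_ranked (G : sgraph) (A : {set G}) (f : G -> G) (rk : G -> nat) :
  {in A, forall v, edge v (f v)} ->
  {in A &, forall u v, u != v -> rk u <= rk v -> ~~ edge u (f v)} ->
  #|A| <= grundy_total_dom G.
Proof.
move=> edgeA rkA; pose s := sort (relpre rk leq) (enum A).
have memA v : (v \in s) = (v \in A) by rewrite mem_sort mem_enum.
have uniq_s : uniq s by rewrite sort_uniq enum_uniq.
have size_s : size s == #|A| by rewrite size_sort -cardE.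
have sorted_s : sorted (relpre rk leq) s by apply: sort_sorted => u v; apply: leq_total.
apply: (@leq_grundy_total_dom G _ (Tuple size_s)).
rewrite /open_nbhd_seq uniq_s; apply/forallP => i.
apply/set0Pn; exists (f (tnth (Tuple size_s) i)).
have inA j : tnth (Tuple size_s) j \in A by rewrite -memA mem_tnth.
rewrite !inE edgeA // andbT; apply/bigcupP => -[j ltji]; rewrite inE; apply/negP.
apply: rkA => //.
  rewrite (inj_eq (elimT (tuple_uniqP (Tuple size_s)) uniq_s)).
  by rewrite -val_eqE /= ltn_eqF.
have tr : transitive (relpre rk leq) by move=> ? ? ?; apply: leq_trans.
pose x0 := tnth (Tuple size_s) i; rewrite !(tnth_nth x0).
by apply: (sorted_ltn_nth tr x0 sorted_s); rewrite ?inE ?(eqP size_s).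
Qed.

Lemma card_odd_ord (n : nat) : #|[set i : 'I_n | odd i]| = n./2.
Proof.
rewrite -sum1dep_card big_mkcond /=; elim: n => [|n IHn]; first by rewrite big_ord0.
by rewrite big_ord_recr /= IHn uphalf_half addnC; case: (odd n).
Qed.

(** * Charging plays to rows in a lexicographic product *)

Section Charging.

Variables (G H : sgraph) (m : nat) (t : m.-tuple (lex_prod G H)).
Hypothesis legal : open_nbhd_seq t.
Hypothesis no_isolated : forall h : H, exists h', edge h h'.

Let row (i : 'I_m) : G := (tnth t i).1.

Definition footprint (i : 'I_m) (w : lex_prod G H) :=
  edge (tnth t i) w && [forall j : 'I_m, (j < i) ==> ~~ edge (tnth t j) w].

Lemma footprintP i w :
  reflect (edge (tnth t i) w /\ forall j : 'I_m, j < i -> ~~ edge (tnth t j) w)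
    (footprint i w).
Proof.
apply: (iffP andP) => -[ew fw]; split=> //.
  by move=> j; apply/implyP/(forallP fw).
by apply/forallP => j; apply/implyP/fw.
Qed.

Lemma footprint_exists i : exists w, footprint i w.
Proof.
case/andP: legal => _ /forallP /(_ i) /set0Pn [w]; rewrite !inE => /andP[fw ew].
exists w; apply/footprintP; split=> // j ltji; apply: contra fw => ejw.
by apply/bigcupP; exists j; rewrite ?inE.
Qed.

(** The last [row i] is only a default: every play of a legal sequence footprints something. *)
Definition charge (i : 'I_m) : G :=
  if [exists h, footprint i (row i, h)] then row i
  else if [pick w | footprint i w] is Some w then w.1 else row i.

Lemma charge_footprint i : exists h, footprint i (charge i, h).
Proof.
rewrite /charge; case: existsP => [//|_]; case: pickP => [[g h] ? | no_w].
  by exists h.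
by have [w] := footprint_exists i; rewrite no_w.
Qed.

Lemma charge_edge i : charge i != row i -> edge (row i) (charge i).
Proof.
have [h /footprintP[+ _]] := charge_footprint i.
by rewrite /edge /= /lex_rel /= -/(row i) eq_sym => /orP[//|/andP[-> ]].
Qed.

Lemma charge_dominated (i i' : 'I_m) (g : G) : i < i' -> edge (row i) g -> charge i' != g.
Proof.
move=> lt_ii' eig; apply/eqP => ch; have [h /footprintP[_ /(_ i lt_ii')]] := charge_footprint i'.
by rewrite ch /edge /= /lex_rel /= -/(row i) eig.
Qed.

(* A play [i] charged elsewhere is the first one in its row, so what it sees there was
   dominated from an adjacent row, which dominates the whole row. *)
Lemma charge_away (i i' : 'I_m) : charge i != row i -> i <= i' -> charge i' != row i.
Proof.
move=> away le_ii'; have ech := charge_edge away.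
have [h' eh'] := no_isolated (tnth t i).2.
have : ~~ footprint i (row i, h').
  apply: contra away => fp; rewrite /charge; case: existsP => // -[].
  by exists h'.
rewrite /footprint negb_and /edge /= /lex_rel /= eqxx eh' orbT /=.
case/forallPn => j; rewrite negb_imply negbK => /andP[lt_ji].
rewrite -/(row j) => /orP[e|/andP[/eqP rowj _]].
  by apply: charge_dominated e; apply: leq_trans le_ii'.
by have := charge_dominated lt_ji; rewrite rowj => /(_ _ ech); rewrite eqxx.
Qed.

End Charging.

(** * Upper bound *)

(** Each edge of a path has exactly one odd endpoint. Both [r] and [f] are injective on [A], so at
    most [l./2] plays have [r] odd, and at most [l./2] have [f] odd. *)
Lemma card_path_legal (l m : nat) (A : {set 'I_m}) (r f : 'I_m -> path_graph l) :
  {in A, forall i, edge (r i) (f i)} ->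
  {in A &, forall i j : 'I_m, i < j -> ~~ edge (r i) (f j)} ->
  #|A| <= (l./2).*2.
Proof.
move=> rf legal.
have lt_total (g : 'I_m -> path_graph l) (B : {set 'I_m}) :
    {in B &, forall i j : 'I_m, i < j -> g i != g j} ->
    {in B, forall i, odd (g i)} -> #|B| <= l./2.
  move=> neq oddB; rewrite -(card_odd_ord l) -(@card_in_imset _ _ g B).
    by apply/subset_leq_card/subsetP => _ /imsetP[i iB ->]; rewrite inE oddB.
  move=> i j iB jB gij; apply/val_inj; case: (ltngtP i j) => // lt_ij.
    by have := neq i j iB jB lt_ij; rewrite gij eqxx.
  by have := neq j i jB iB lt_ij; rewrite gij eqxx.
rewrite -(cardsID [set i | odd (r i)] A) -addnn; apply: leq_add.
  apply: (lt_total r) => [i j|i]; rewrite !inE => /andP[iA //].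
  move=> _ /andP[jA _] /(legal _ _ iA jA); apply: contra => /eqP->; exact: rf.
apply: (lt_total f) => [i j|i]; rewrite !inE => /andP[+ iA].
  move=> _ /andP[_ jA] /(legal _ _ iA jA); apply: contra => /eqP<-; exact: rf.
move: (rf _ iA); rewrite /edge /= /path_rel /= => /orP[] /eqP; lia.
Qed.

Section PathUpper.

Variables (k l m : nat) (t : m.-tuple (lex_prod (path_graph k) (path_graph l))).
Hypotheses (legal : open_nbhd_seq t) (l_gt1 : 1 < l).

Lemma path_no_isolated (h : path_graph l) : exists h' : path_graph l, edge h h'.
Proof.
have := ltn_ord h; case: (posnP h) => [h0 _|h_gt0 lt_hl].
  by exists (Ordinal l_gt1); rewrite /edge /= /path_rel /= h0.
have lt : h.-1 < l by lia.
by exists (Ordinal lt); rewrite /edge /= /path_rel /= prednK // eqxx orbT.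
Qed.

Let row (i : 'I_m) : nat := (tnth t i).1 : 'I_k.
Let chg (i : 'I_m) : nat := charge t i : 'I_k.

Definition charged n := [set i | chg i == n].

Lemma chg_near i : [|| chg i == row i, chg i == (row i).+1 | (chg i).+1 == row i].
Proof.
case: (eqVneq (charge t i) (tnth t i).1) => [e|/(charge_edge legal)].
  by rewrite /chg /row e eqxx.
rewrite /edge /= /path_rel /= -/(chg i) -/(row i); lia.
Qed.

Lemma chg_dominated (i i' : 'I_m) (n : nat) : i < i' ->
  ((row i).+1 == n) || (n.+1 == row i) -> chg i' != n.
Proof.
move=> lt_ii' e; apply/eqP => ch.
have := @charge_dominated _ _ _ _ legal i i' (charge t i') lt_ii'.
rewrite eqxx /edge /= /path_rel /= -/(chg i') -/(row i) ch e.
by move/(_ isT).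
Qed.

Lemma chg_away (i i' : 'I_m) : chg i != row i -> i <= i' -> chg i' != row i.
Proof. exact: (charge_away legal path_no_isolated). Qed.

(** Of two plays charged to row [n], the earlier lies in it, or it would dominate the row. Only the
    last may come from outside; any neighbour serves as its [r], which legality never tests. *)
Lemma card_charged n : #|charged n| <= (l./2).*2.
Proof.
have pairs i : exists w : path_graph l * path_graph l,
    [/\ edge w.1 w.2, footprint t i (charge t i, w.2)
      & charge t i = (tnth t i).1 -> w.1 = (tnth t i).2].
  have [f fp] := charge_footprint legal i.
  case: (eqVneq (charge t i) (tnth t i).1) => [e|away].
    exists ((tnth t i).2, f); split=> //=; case/footprintP: fp => + _.
    by rewrite e /edge /= /lex_rel /= path_rel_irrefl eqxx.
  have [r] := path_no_isolated f; rewrite edge_sym => er.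
  by exists (r, f); split=> // e; rewrite e eqxx in away.
have [w wP] := fin_all_exists pairs.
apply: (@card_path_legal _ _ _ (fun i => (w i).1) (fun i => (w i).2)).
  by move=> i _; case: (wP i).
move=> i j; rewrite !inE => /eqP ci /eqP cj lt_ij.
have cij : charge t i = charge t j by apply: val_inj; apply: etrans ci _.
have ri : charge t i = (tnth t i).1.
  apply/eqP/negPn/negP => /(charge_edge legal) /(charge_dominated legal lt_ij).
  by rewrite cij eqxx.
have [_ /footprintP[_ /(_ i lt_ij) nfp] _] := wP j; have [_ _ /(_ ri) ->] := wP i.
by move: nfp; apply: contra; rewrite -cij ri /edge /= /lex_rel /= eqxx => ->; rewrite orbT.
Qed.

Definition charged_above n := forall i, chg i = n -> row i = n.+1.

Lemma charged_above_leq1 n : charged_above n -> #|charged n| <= 1.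
Proof.
move=> above; apply/card_le1_eqP => i j; rewrite !inE => /eqP ci /eqP cj.
have ri := above _ ci; have rj := above _ cj.
apply/val_inj; case: (ltngtP i j) => // /chg_dominated dom; have := dom n;
  by rewrite ?ri ?rj ?ci ?cj !eqxx orbT => /(_ isT).
Qed.

(** Of two plays charged to row [n], the earlier [x] lies in it and dominates row [n.+1], so a play
    charged there precedes [x]. From row [n] it would be charged away, from row [n.+1] it would
    dominate row [n]; both prevent the charge of [x]. *)
Lemma charged_above_start n : 1 < #|charged n| -> charged_above n.+1.
Proof.
have chgs_neq : forall i j : 'I_m, i < j -> chg i = n -> chg j = n -> row i = n.
  move=> i j lt_ij ci cj; have := chg_near i; have := @chg_dominated i j n lt_ij.
  rewrite ci cj eqxx; lia.
have main (x y i : 'I_m) : x < y -> chg x = n -> chg y = n -> chg i = n.+1 -> row i = n.+2.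
  move=> lt_xy cx cy ci; have rx := chgs_neq x y lt_xy cx cy.
  have := @chg_dominated x i n.+1; have := @chg_dominated i y n.
  have := @chg_away i x; have := @chg_away i y; have := chg_near i.
  rewrite rx cx cy ci; lia.
case/card_gt1P => x [y []]; rewrite !inE -val_eqE /= neq_ltn => /eqP cx /eqP cy.
by case/orP => lt i; [apply: (main x y) | apply: (main y x)].
Qed.

(** The play [p] is charged away from row [n.+1], so a play charged there precedes [p]; lying in row
    [n] or [n.+1], it would prevent the charge of [p]. *)
Lemma charged_above_next n :
  charged_above n -> 0 < #|charged n| -> charged_above n.+1.
Proof.
move=> above /card_gt0P[p]; rewrite inE => /eqP cp i ci; have rp := above p cp.
have := @chg_dominated i p n; have := @chg_away p i; have := @chg_away i p.
have := chg_near i; rewrite cp rp ci; lia.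
Qed.

Let T := (l./2).*2.
Let bound n := n./2 * T + odd n.

(** In the second state the count may be one step of [bound] ahead, and row [n] has at most one
    charge; a row without charges restores the first state. *)
Lemma card_charged_below n :
  let F := #|[set i | chg i < n]| in
  F <= bound n \/ charged_above n /\ F <= bound n.+1.
Proof.
have T_gt1 : 1 < T by rewrite /T; lia.
elim: n => [|n IHn] /=.
  by left; rewrite leqn0 cards_eq0; apply/eqP/setP => i; rewrite !inE.
have -> : #|[set i | chg i < n.+1]| = #|[set i | chg i < n]| + #|charged n|.
  rewrite -(cardsID [set i | chg i < n]); congr (_ + _).
    by congr #|pred_of_set _|; apply/setP => i; rewrite !inE; lia.
  by congr #|pred_of_set _|; apply/setP => i; rewrite !inE; lia.
have bound2 j : bound j.+2 = bound j + T by rewrite /bound /= negbK; lia.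
(* From an odd index the gain is [T - 1], positive by [T_gt1]. *)
have boundS j : bound j < bound j.+1.
  by rewrite /bound; have [b [->|->]] : exists b, j = b.*2 \/ j = b.*2.+1;
     [exists j./2; lia | |]; rewrite /=; nia.
have cn := card_charged n; rewrite -/T in cn.
have := boundS n; have := bound2 n; have := boundS n.+1.
case: IHn => [le1 | [above le2]].
  case: (leqP #|charged n| 1) => [c1|/charged_above_start above']; first by left; lia.
  by right; split=> //; lia.
have := charged_above_leq1 above.
case: (posnP #|charged n|) => [c0|/(charged_above_next above) above'].
  by left; lia.
by right; split=> //; lia.
Qed.

Lemma path_lex_upper : m <= bound k.+1.
Proof.
have mE : #|[set i | chg i < k]| = m.
  rewrite -[RHS]card_ord -cardsT; congr #|pred_of_set _|; apply/setP => i.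
  by rewrite !inE /chg ltn_ord.
have := card_charged_below k; rewrite mE.
suff : bound k <= bound k.+1 by lia.
rewrite /bound; have : 1 < T by rewrite /T; lia.
by have [b [->|->]] : exists b, k = b.*2 \/ k = b.*2.+1;
     [exists k./2; lia | |]; rewrite /=; nia.
Qed.

End PathUpper.

(** * Lower bound *)

Lemma card_ltn_ord (n b : nat) : b <= n -> #|[set i : 'I_n | i < b]| = b.
Proof.
move=> le_bn; have inj : injective (widen_ord le_bn).
  by move=> i j /(congr1 val) ij; apply: val_inj.
rewrite -[RHS]card_ord -cardsT -(card_imset _ inj).
congr #|pred_of_set _|; apply/setP => i; rewrite inE.
apply/idP/imsetP => [lt_ib|[j _ ->]]; last exact: ltn_ord j.
by exists (Ordinal lt_ib) => //; apply: val_inj.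
Qed.

Section PathLower.

Variables (k l : nat) (k_gt2 : 2 < k) (l_gt0 : 0 < l).

Let T := (l./2).*2.
Let mate (a : nat) := if odd a then a.-1 else a.+1.
(* Even vertices come first, increasingly, then odd ones, decreasingly: each
   vertex [a < T] then footprints [mate a]. *)
Let prank (a : nat) := if odd a then l - a else a.

(** Only equal parities can conflict. Besides [b], [mate b] has at most one neighbour, [b + 2] for
    even [b] and [b - 2] for odd [b], of larger rank. *)
Lemma path_mate_legal a b : a < T -> b < T -> a != b -> prank a <= prank b ->
  (a.+1 != mate b) && ((mate b).+1 != a).
Proof. rewrite /T /prank /mate; case: ifP; case: ifP; lia. Qed.

Let row1 : 'I_k := Ordinal (ltnW k_gt2).
Let row2 : 'I_k := Ordinal k_gt2.
Let bridge : lex_prod (path_graph k) (path_graph l) := (row1, Ordinal l_gt0).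

(* With [b = true], a single vertex of row 1 is played after row 0 and before
   all other rows, and footprints a vertex of row 2. *)
Lemma path_lex_lower (R : {set 'I_k}) (b : bool) :
  {in R &, forall i j : 'I_k, i.+1 != j} ->
  {in R, forall i : 'I_k, (i != 1 :> nat) && (b ==> (i != 2 :> nat))} ->
  #|R| * T + b <= grundy_total_dom (lex_prod (path_graph k) (path_graph l)).
Proof.
move=> indep R12; pose L := [set h : 'I_l | h < T].
have le_Tl : T <= l by rewrite /T; lia.
pose B : {set lex_prod (path_graph k) (path_graph l)} := setX R L.
pose A := if b then bridge |: B else B.
have bridgeNB : bridge \notin B.
  by rewrite inE /=; apply/negP => /andP[/R12].
have -> : #|R| * T + b = #|A|.
  rewrite -(card_ltn_ord le_Tl) -cardsX /A; case: (b) => //=; last by rewrite addn0.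
  by rewrite cardsU1 bridgeNB addnC.
(* Mates stay below the even number [T], so the default of [insubd] is harmless. *)
pose f (x : lex_prod (path_graph k) (path_graph l)) : lex_prod (path_graph k) (path_graph l) :=
  if x == bridge then (row2, x.2) else (x.1, insubd (x.2 : 'I_l) (mate x.2)).
(* As [prank] is at most [l], the factor [l.+1] compares rows first. *)
pose rk (x : lex_prod (path_graph k) (path_graph l)) : nat := (x.1 : 'I_k) * l.+1 + prank (x.2 : 'I_l).
have inA x : x \in A -> b && (x == bridge) \/ [/\ x != bridge, x.1 \in R & (x.2 : 'I_l) < T].
  have inB : x \in B -> [/\ x != bridge, x.1 \in R & (x.2 : 'I_l) < T].
    case: (eqVneq x bridge) => [->|_]; first by rewrite (negbTE bridgeNB).
    by rewrite !inE => /andP[].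
  rewrite /A; case: (b) => [/setU1P[->|/inB]|/inB]; [by left | by right | by right].
have val_mate (x : 'I_l) : x < T -> insubd x (mate x) = mate x :> nat.
  move=> lt_xT; rewrite val_insubd; case: ifP => //.
  by rewrite /mate; move: lt_xT le_Tl; rewrite /T; case: ifP; lia.
apply: (@leq_grundy_ranked _ A f rk).
  move=> x /inA[/andP[_ /eqP->]|[xb xR xT]]; first by rewrite /f eqxx.
  rewrite /f (negbTE xb) /edge /= /lex_rel /= eqxx /edge /= /path_rel /= val_mate //.
  by rewrite /mate; case: ifP; lia.
move=> x y /inA[/andP[hb /eqP->]|[xb xR xT]] /inA[/andP[hb' /eqP->]|[yb yR yT]].
- by rewrite eqxx.
- move=> _; rewrite /f (negbTE yb) /rk /edge /= /lex_rel /= /edge /= /path_rel /=.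
  have := R12 _ yR; rewrite hb -val_eqE /=; case: (y.1 : 'I_k) => [[|[|[|c]]] ?] //= _.
  have := ltn_ord (y.2 : 'I_l); rewrite /prank /=; case: ifP; lia.
- move=> _; rewrite /f eqxx /rk /edge /= /lex_rel /= /edge /= /path_rel /=.
  have := R12 _ xR; rewrite hb' -val_eqE /=.
  by case: (x.1 : 'I_k) => [[|[|[|[|c]]]] ?] //= _; rewrite /prank /=; lia.
have := indep _ _ xR yR; have := indep _ _ yR xR.
rewrite /f (negbTE yb) /rk /edge /= /lex_rel /= /edge /= /path_rel /= val_mate //.
move=> /negbTE-> /negbTE-> /= xy; case: eqP => //= eq1; rewrite eq1 leq_add2l.
move: xy; rewrite -pair_eqE /pair_eq /= eq1 eqxx /= => xy.
by move=> le; rewrite negb_or; apply: path_mate_legal.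
Qed.

End PathLower.

Lemma grundy_path_lex_path (k l : nat) : 2 < k -> 1 < l ->
  grundy_total_dom (lex_prod (path_graph k) (path_graph l)) =
    uphalf k * (l./2).*2 + ~~ odd k.
Proof.
move=> k_gt2 l_gt1; have l_gt0 := ltnW l_gt1; apply/eqP; rewrite eqn_leq; apply/andP; split.
  have [t legal] := grundy_total_dom_attained (lex_prod (path_graph k) (path_graph l)).
  exact: path_lex_upper legal l_gt1.
case: (boolP (odd k)) => odd_k.
  pose R := [set i : 'I_k | ~~ odd i].
  have -> : uphalf k = #|R|.
    have -> : R = ~: [set i : 'I_k | odd i] by apply/setP => i; rewrite !inE.
    by rewrite cardsCs setCK card_odd_ord card_ord; lia.
  apply: (path_lex_lower k_gt2 l_gt0 (b := false)) => [i j|i]; rewrite !inE; first lia.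
  by case: i => [[|[]]].
pose i0 : 'I_k := Ordinal (ltnW (ltnW k_gt2)); pose i1 : 'I_k := Ordinal (ltnW k_gt2).
(* Row 0 replaces row 1 among the odd rows, which keeps [k./2] rows and frees rows 1 and 2. *)
pose R := i0 |: [set i : 'I_k | odd i] :\ i1.
have -> : uphalf k = #|R|.
  rewrite cardsU1 !inE /=; have := cardsD1 i1 [set i : 'I_k | odd i].
  by rewrite card_odd_ord !inE /=; lia.
apply: (path_lex_lower k_gt2 l_gt0 (b := true)) => [i j|i]; rewrite !inE -!val_eqE /=; lia.
Qed.

(* k./2 is k / 2 rounded down (exact for even k); uphalf k is its ceiling. *)
Theorem corollary3p4 (k l : nat) (hk : 2 < k) (hl : 2 < l) :
  (~~ odd l ->
     grundy_total_dom (lex_prod (path_graph k) (path_graph l)) =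
       if ~~ odd k then k./2 * l + 1 else uphalf k * l) /\
  (odd l ->
     grundy_total_dom (lex_prod (path_graph k) (path_graph l)) =
       if ~~ odd k then k./2 * (l - 1) + 1 else uphalf k * (l - 1)).
Proof.
rewrite (grundy_path_lex_path hk (ltnW hl)) uphalf_half.
by split=> odd_l; [have -> : (l./2).*2 = l by lia | have -> : (l./2).*2 = l - 1 by lia];
  case: (odd k); rewrite ?addn0.
Qed.
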